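(* Let $X$ be an atriodic semi-Kelley continuum. Then $X$ is hereditarily semi-Kelley.
   Context: A continuum is a compact connected metric space with more than one point. A subcontinuum of a continuum $X$ is a non-empty compact connected subset of $X$ (one-point sets are allowed). Convergence of subcontinua is with respect to the Hausdorff metric. A 3-od is a continuum $Z$ containing a subcontinuum $B$ (called a core of $Z$) such that $Z\setminus B$ has at least 3 components. A continuum is atriodic if it contains no 3-ods (i.e. none of its subcontinua is a 3-od). Let $K$ be a subcontinuum of $X$. A maximal limit continuum of $K$ is a subcontinuum $M\subset K$ for which there is a sequence $\{M_n\}_{n=1}^\infty$ of subcontinua of $X$ converging to $M$ such that for each convergent sequence $\{M_n'\}_{n=1}^\infty$ of subcontinua of $X$ with $M_n\subset M_n'$ for each $n\in\mathbb N$ and $\lim M_n'=M'\subset K$, we have $M'=M$. A continuum $X$ is semi-Kelley if for each subcontinuum $K$ of $X$ and every two maximal limit continua $L$ and $M$ of $K$, either $L\subset M$ or $M\subset L$. A continuum $X$ is hereditarily semi-Kelley if each subcontinuum of $X$ is semi-Kelley (one-point subcontinua are trivially semi-Kelley). *)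

(* Defs.v *)
From HB Require Import structures.
From mathcomp Require Import all_boot all_order all_algebra.
From mathcomp Require Import all_classical all_reals topology normedtype.

Set Implicit Arguments.
Unset Strict Implicit.
Unset Printing Implicit Defensive.

Import Order.TTheory GRing.Theory Num.Theory.
Import numFieldNormedType.Exports.

Local Open Scope classical_set_scope.
Local Open Scope ring_scope.

(* Continua are represented as subsets of an ambient metric space [T], with the
   induced metric; a continuum given as a space is the case [X = setT]. *)
Section continua.
Context {R : realType} {T : metricType R}.
Implicit Types (X Y Z K L M A B : set T).

Definition continuum X : Prop :=
  [/\ compact X, connected X & exists x y, [/\ X x, X y & x != y]].

Definition subcontinuum X A : Prop :=
  [/\ A `<=` X, A !=set0, compact A & connected A].

Definition neighborhood A (e : R) : set T :=
  \bigcup_(a in A) [set x | mdist a x < e].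

(* [inf] has its intended meaning only when the set is nonempty, which holds
   for nonempty bounded sets, hence for subcontinua. *)
Definition hausdorff_dist A B : R :=
  inf [set e : R | [/\ 0 < e, A `<=` neighborhood B e
                            & B `<=` neighborhood A e]].

Definition hausdorff_cvg (A_ : nat -> set T) A : Prop :=
  hausdorff_dist (A_ n) A @[n --> \oo] --> (0 : R).

Definition components A : set (set T) :=
  [set connected_component A x | x in A].

Definition is_3od Z : Prop :=
  continuum Z /\
  exists2 B, subcontinuum Z B & (`I_3 #<= components (Z `\` B))%card.

Definition atriodic X : Prop := forall Z, subcontinuum X Z -> ~ is_3od Z.

(* Limits are required to be subcontinua because a Hausdorff limit is unique
   only among closed sets. *)
Definition maximal_limit_continuum X K M : Prop :=
  subcontinuum K M /\
  exists M_ : nat -> set T,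
    [/\ forall n, subcontinuum X (M_ n),
        hausdorff_cvg M_ M
      & forall (M'_ : nat -> set T) (M' : set T),
          (forall n, subcontinuum X (M'_ n)) ->
          subcontinuum X M' ->
          hausdorff_cvg M'_ M' ->
          (forall n, M_ n `<=` M'_ n) ->
          M' `<=` K ->
          M' = M].

Definition semi_kelley X : Prop :=
  forall K, subcontinuum X K ->
  forall L M, maximal_limit_continuum X K L -> maximal_limit_continuum X K M ->
    L `<=` M \/ M `<=` L.

Definition hereditarily_semi_kelley X : Prop :=
  forall Y, subcontinuum X Y -> semi_kelley Y.

End continua.

(* Main.v *)
(** Every maximal limit continuum of [K] in [Y] is one of [K] in [X], so the
    semi-Kelley property of [X] transfers to [Y].  The point is that if
    [M_ n `<=` Y], [M_ n `<=` M'_ n `<=` X] and [M'_ n] converges to [M' `<=` Y],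
    then the [M'_ n] can be replaced by subcontinua of [Y].  Otherwise, for
    infinitely many [n] the component [E n] of [M_ n] in a small closed
    neighborhood of [M'] in [Y] misses [M'], hence infinitely many of the [E n]
    are pairwise disjoint.  Take five of them and let [U] be the union of the
    five [M'_ n].  As [Y] is not the core of a 3-od, [U `\` Y] has at most two
    components, and every [E n] meets the closure of one of them.  So the closure
    of a single component meets three of the [E n]; these leave the neighborhood
    of [M'] while that closure does not, and they form with it a 3-od. *)
Require Import Defs.
From mathcomp Require Import all_boot all_order all_algebra.
From mathcomp Require Import all_classical all_reals topology normedtype.

Set Implicit Arguments.
Unset Strict Implicit.
Unset Printing Implicit Defensive.

Import Order.TTheory GRing.Theory Num.Theory.
Import numFieldNormedType.Exports.

Local Open Scope classical_set_scope.
Local Open Scope ring_scope.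

(** * Quasi-components and components of compact sets *)

Section quasi_components.
Context {R : realType} {T : metricType R}.
Implicit Types (F D N S : set T) (x : T).

(* For closed [F], the relatively clopen subsets of [F] containing [x]; their
   intersection is the quasi-component of [x], which for compact [F] is the
   component. *)
Let clopens F x : set (set T) :=
  [set S | [/\ closed S, closed (F `\` S), S x & S `<=` F]].

Lemma closed_disjoint_opens (A B : set T) : closed A -> closed B ->
  A `&` B = set0 ->
  exists U V, [/\ open U, open V, A `<=` U, B `<=` V & U `&` V = set0].
Proof.
move=> cA cB AB.
have /(@normal_openP R) : normal_space T by exact: pseudometric_normal.
exact.
Qed.

(** Since [clopens F x] is stable under intersection, the sets [S]\[W] would form a proper filter
    base if none were empty. A cluster point in the compact [F] would then lie in every [S] but
    outside [W]. *)
Lemma bigcap_clopens_sub_open F x W : compact F -> F x -> open W ->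
  \bigcap_(S in clopens F x) S `<=` W -> exists2 S, clopens F x S & S `<=` W.
Proof.
move=> cF Fx oW QW; apply: contrapT => noS.
have clF : closed F by apply: compact_closed cF; exact: metric_hausdorff.
have clopF : clopens F x F by split => //; rewrite setDv; exact: closed0.
pose G := filter_from (clopens F x) (fun S => S `\` W).
have GF : ProperFilter G.
  apply: filter_from_proper.
    apply: filter_from_filter; first by exists F.
    move=> S S' [cS cFS Sx SF] [cS' cFS' S'x S'F]; exists (S `&` S').
      split => //.
      - exact: closedI.
      - by rewrite setDIr; exact: closedU.
      - by move=> y [/SF].
    by move=> y [[Sy S'y] Wy].
  move=> S clopS; apply: contrapT => /nonemptyPn SW; apply: noS; exists S => //.
  by rewrite -setD_eq0.
have [z [Fz Gz]] : F `&` cluster G !=set0.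
  by apply: cF; exists F => // y [].
have clz S : clopens F x S -> (S `\` W) z.
  move=> clopS; have [cS _ _ _] := clopS.
  have : closed (S `\` W).
    by rewrite setDE; apply: closedI => //; exact: open_closedC.
  by apply => V Vz; apply: Gz Vz; exists S.
have [_ nWz] := clz _ clopF; by apply: nWz; apply: QW => S /clz [].
Qed.

(** A splitting into two closed pieces is enlarged to disjoint open sets [U] and [V]. Some clopen
    [S] lies in [U]|[V], and its trace on the side of [x] is again clopen in [F], so the whole
    intersection lies on that side. *)
Lemma bigcap_clopens_connected F x : compact F -> F x ->
  connected (\bigcap_(S in clopens F x) S).
Proof.
move=> cF Fx; set Q := (X in connected X) => P P0 [O oO PO] [C cC PC].
have cQ : closed Q by apply: closed_bigI => S [].
have cP : closed P by rewrite PC; exact: closedI.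
have cP' : closed (Q `\` P).
  have -> : Q `\` P = Q `&` ~` O.
    by rewrite PO setDIr setDv set0U setDE.
  by apply: closedI => //; exact: open_closedC.
have [U [V [oU oV PU QV UV]]] := closed_disjoint_opens cP cP' (setDIK _ _).
have QUV : Q `<=` U `|` V.
  move=> y Qy; have [/PU|nPy] := pselect (P y); first by left.
  by right; apply: QV.
have [S [cS cFS Sx SF] SUV] :=
  bigcap_clopens_sub_open cF Fx (openU oU oV) QUV.
have main A B : open A -> open B -> A `&` B = set0 -> S `<=` A `|` B -> A x ->
    Q `<=` A.
  move=> oA oB AB SAB Ax y /(_ (S `&` A)) [] //; split => //.
  - have -> : S `&` A = S `&` ~` B.
      apply/seteqP; split => z [Sz].
        by move=> Az; split => // Bz; rewrite -[False]/(set0 z) -AB.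
      by move=> Bz; split => //; case: (SAB _ Sz).
    by apply: closedI => //; exact: open_closedC.
  - rewrite setDIr; apply: closedU => //.
    have -> : F `\` A = ((F `\` S) `&` ~` A) `|` (S `&` ~` A).
      apply/seteqP; split => [z [Fz Az]|z [[[Fz _] Az]|[/SF]]] //.
      by have [Sz|Sz] := pselect (S z); [right|left].
    apply: closedU; apply: closedI => //; exact: open_closedC.
  - by move=> z [/SF].
have [Ux|Vx] : (U `|` V) x by exact: SUV.
  have QU := main _ _ oU oV UV SUV Ux.
  apply/seteqP; split => [y|y Qy]; first by rewrite PO => -[].
  apply: contrapT => nPy; rewrite -[False]/(set0 y) -UV; split; first exact: QU.
  exact: QV.
have QV' : Q `<=` V by apply: main oV oU _ _ Vx; [rewrite setIC|rewrite setUC].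
case: P0 => p Pp; exfalso; rewrite -[False]/(set0 p) -UV; split; first exact: PU.
by apply: QV'; move: Pp; rewrite PO => -[].
Qed.

(** A form of boundary bumping: a connected set can leave [F] through [D] only if the component it
    starts from reaches [D]. Otherwise the quasi-component, being inside the component, misses [D],
    so some clopen [S] does; this [S] is separated from the rest of [F]|[D] and traps [N]. *)
Lemma connected_sub_of_component_disjoint F D N x : compact F -> closed D ->
  connected N -> N `<=` F `|` D -> N x -> F x ->
  connected_component F x `&` D = set0 -> N `<=` F.
Proof.
move=> cF cD cN NFD Nx Fx FxD.
have [] := @bigcap_clopens_sub_open F x (~` D) cF Fx.
- exact: closed_openC.
- move=> y Qy Dy; rewrite -[False]/(set0 y) -FxD; split => //.
  apply: connected_component_max Qy.
  + by move=> S [].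
  + move=> z; apply; split => //.
      by apply: compact_closed cF; exact: metric_hausdorff.
    by rewrite setDv; exact: closed0.
  + exact: bigcap_clopens_connected.
move=> S [cS cFS Sx SF] SD.
have sep : separated S ((F `\` S) `|` D).
  have cFSD : closed ((F `\` S) `|` D) by exact: closedU.
  rewrite /separated -(iffLR (closure_id _) cS) -(iffLR (closure_id _) cFSD).
  have SD0 : S `&` ((F `\` S) `|` D) = set0.
    by apply/seteqP; split => // y [Sy [[]|/(SD _ Sy)]].
  by split.
have NS : N `<=` S `|` ((F `\` S) `|` D).
  move=> y /NFD [Fy|Dy]; last by right; right.
  by have [Sy|Sy] := pselect (S y); [left|right; left].
have [NS'|NS'] := connected_subset sep NS cN.
  exact: subset_trans SF.
by have := NS' _ Nx; case=> [[]|/(SD _ Sx)].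
Qed.

End quasi_components.

(** * Neighborhoods and Hausdorff convergence *)

Section hausdorff_convergence.
Context {R : realType} {T : metricType R}.
Implicit Types (A B K : set T) (e : R).

Lemma neighborhoodE A e : neighborhood A e = \bigcup_(a in A) ball a e.
Proof. by apply: eq_bigcupr => a _; rewrite ballEmdist. Qed.

Lemma neighborhood_open A e : open (neighborhood A e).
Proof.
rewrite neighborhoodE openE => x [a Aa ax].
move: ax; rewrite ballEmdist/= => ax.
apply/nbhs_ballP; exists (e - mdist a x) => /=; first by rewrite subr_gt0.
move=> y; rewrite ballEmdist/= => xy; exists a => //; rewrite ballEmdist/=.
by apply: le_lt_trans (metric_triangle a x y) _; rewrite -ltrBrDl.
Qed.

Lemma neighborhood_le A e e' : e <= e' -> neighborhood A e `<=` neighborhood A e'.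
Proof. by move=> ee' x [a Aa /= ax]; exists a => //=; exact: lt_le_trans ee'. Qed.

Lemma sub_neighborhood A e : 0 < e -> A `<=` neighborhood A e.
Proof. by move=> e0 x Ax; exists x => //=; rewrite mdistxx. Qed.

Lemma neighborhood_closure A e : 0 < e ->
  closure (neighborhood A (e / 2)) `<=` neighborhood A e.
Proof.
move=> e0 x clx; have e20 : 0 < e / 2 by rewrite divr_gt0.
have [y [[a Aa /= ay]]] := clx _ (nbhsx_ballx x _ e20).
rewrite ballEmdist/= metric_sym => yx; exists a => //=.
by apply: le_lt_trans (metric_triangle a y x) _; rewrite [e]splitr ltrD.
Qed.

(** Used in both directions, this makes the set of radii in [hausdorff_dist] nonempty, so that its
    infimum is meaningful. *)
Lemma compact_sub_neighborhood A B : compact A -> B !=set0 ->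
  exists2 e, 0 < e & A `<=` neighborhood B e.
Proof.
move=> /compact_near_coveringP cA [b Bb].
have H : \forall i \near +oo, A `<=` (fun x => mdist b x < i).
  apply: (cA R +oo (fun i x => mdist b x < i)) => x Ax.
  exists (ball x 1, [set i | mdist b x + 1 < i]) => /=.
    split; first exact: nbhsx_ballx.
    by apply: nbhs_pinfty_gt; exact: num_real.
  move=> [y i]/= []; rewrite ballEmdist/= => xy; apply: lt_trans.
  by apply: le_lt_trans (metric_triangle b x y) _; rewrite ltrD2l.
have P0 : \forall i \near +oo, (0 : R) < i.
  by apply: nbhs_pinfty_gt; exact: num_real.
have [i [Ai i0]] := filter_ex (filterI H P0).
by exists i => // x /Ai /= bx; exists b.
Qed.

Lemma hausdorff_dist_lt A B e : compact A -> compact B -> A !=set0 -> B !=set0 ->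
  hausdorff_dist A B < e -> A `<=` neighborhood B e /\ B `<=` neighborhood A e.
Proof.
move=> cA cB A0 B0 /inf_lt [].
  have [d d0 Ad] := compact_sub_neighborhood cA B0.
  have [d' d'0 Bd] := compact_sub_neighborhood cB A0.
  exists (Num.max d d'); split; first by rewrite lt_max d0.
    by apply: subset_trans Ad _; apply: neighborhood_le; rewrite le_max lexx.
  by apply: subset_trans Bd _; apply: neighborhood_le; rewrite le_max lexx orbT.
move=> d [d0 Ad Bd] de.
split; [apply: subset_trans Ad _ | apply: subset_trans Bd _];
  apply: neighborhood_le; exact: ltW.
Qed.

Lemma hausdorff_dist_ge0 A B : 0 <= hausdorff_dist A B.
Proof.
rewrite /hausdorff_dist; set E := (X in inf X).
(* The infimum of the empty set is 0 by convention, so the bound survives in that case. *)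
have [->|/set0P E0] := eqVneq E set0; first by rewrite inf0.
by apply: lb_le_inf => // e [/ltW].
Qed.

Lemma hausdorff_dist_le A B e : 0 < e -> A `<=` neighborhood B e ->
  B `<=` neighborhood A e -> hausdorff_dist A B <= e.
Proof.
by move=> e0 AB BA; apply: ge_inf; [exists 0 => d [/ltW] | split].
Qed.

Lemma hausdorff_cvgP (A_ : nat -> set T) A :
  (forall n, compact (A_ n)) -> (forall n, A_ n !=set0) ->
  compact A -> A !=set0 ->
  hausdorff_cvg A_ A <-> (forall e, 0 < e -> \forall n \near \oo,
    A_ n `<=` neighborhood A e /\ A `<=` neighborhood (A_ n) e).
Proof.
move=> cA_ A_0 cA A0; split => [/cvgrPdist_lt H e e0|H].
  have := H _ e0; apply: filterS => n; rewrite sub0r normrN.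
  rewrite ger0_norm; last exact: hausdorff_dist_ge0.
  exact: hausdorff_dist_lt.
apply/cvgrPdist_le => e e0; have := H _ e0; apply: filterS => n [An nA].
rewrite sub0r normrN ger0_norm; last exact: hausdorff_dist_ge0.
exact: hausdorff_dist_le.
Qed.

End hausdorff_convergence.

(** * Components, 3-ods and unions of subcontinua *)

Section components.
Context {R : realType} {T : metricType R}.
Implicit Types (X Y Z A B C D E : set T).

Lemma card_components_ge3 A (x : nat -> T) :
  (forall i, (i < 3)%N -> A (x i)) ->
  (forall i j, (i < 3)%N -> (j < 3)%N -> i <> j ->
    ~ connected_component A (x i) (x j)) ->
  (`I_3 #<= components A)%card.
Proof.
move=> Ax sepx; pose f i := connected_component A (x i).
have finj : {in `I_3 &, injective f}.
  move=> i j /set_mem /= i3 /set_mem /= j3 fij; apply: contrapT => nij.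
  apply: (sepx i j) => //; rewrite -/(f i) fij.
  by apply: connected_component_refl; exact: Ax.
have : (f @` `I_3 #<= components A)%card.
  by apply: subset_card_le => _ [i i3 <-]; exists (x i) => //; exact: Ax.
by apply: card_le_trans; have := inj_card_eq finj; rewrite card_eq_le => /andP[].
Qed.

(** A point outside two distinct components would produce a third. Empty [C] or [D] account for
    fewer than two components. *)
Lemma components_lt3 A : ~ (`I_3 #<= components A)%card ->
  exists C D, [/\ connected C, connected D & A = C `|` D].
Proof.
move=> A3; have [|/nonemptyPn ->] := pselect (A !=set0); last first.
  by exists set0, set0; rewrite setU0; split => //; exact: connected0.
move=> [x Ax]; pose C := connected_component A x.
have CA : C `<=` A by exact: connected_component_sub.
have cC : connected C by exact: component_connected.
have [|AC] := pselect (exists2 y, A y & ~ C y); last first.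
  exists C, set0; split; rewrite ?setU0 //; first exact: connected0.
  apply/seteqP; split => // y Ay; apply: contrapT => nCy.
  by apply: AC; exists y.
move=> [y Ay nCy]; exists C, (connected_component A y); split => //.
  exact: component_connected.
apply/seteqP; split => [z Az|z [/CA//|/connected_component_sub//]].
apply: contrapT => /not_orP [nCz nDz]; apply: A3.
have nzy : ~ connected_component A z y by move/connected_component_sym.
have nyx : ~ connected_component A y x by move/connected_component_sym.
have nzx : ~ connected_component A z x by move/connected_component_sym.
by apply: (@card_components_ge3 A (nth x [:: x; y; z])) =>
  [[|[|[|]]]|[|[|[|i]]] [|[|[|j]]]].
Qed.

(** A 3-od must have two distinct points, and this is automatic: a one-point [Z] equals its core,
    which leaves no component at all. *)
Lemma atriodic_components X Z B : atriodic X -> subcontinuum X Z ->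
  subcontinuum Z B -> ~ (`I_3 #<= components (Z `\` B))%card.
Proof.
move=> atX XZ ZB card3; have [ZX Z0 cZ conZ] := XZ.
apply: (atX _ XZ); split; last by exists B.
split => //; have [BZ [b Bb] _ _] := ZB; apply: contrapT => Z1.
have ZB0 : Z `\` B = set0.
  apply/seteqP; split => // y [Zy nBy]; apply: Z1; exists y, b; split => //.
    exact: BZ.
  by apply/eqP => yb; apply: nBy; rewrite yb.
move: card3; rewrite ZB0 /components image_set0 => /card_le0P I30.
by have : `I_3 0%N by []; rewrite I30.
Qed.

Lemma atriodic_setD_connectedU X Z B : atriodic X -> subcontinuum X Z ->
  subcontinuum Z B ->
  exists C D, [/\ connected C, connected D & Z `\` B = C `|` D].
Proof.
by move=> atX XZ ZB; apply: components_lt3;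
  exact: (atriodic_components atX XZ ZB).
Qed.

Lemma subcontinuum_closed X A : subcontinuum X A -> closed A.
Proof. by case=> _ _ + _; apply: compact_closed; exact: metric_hausdorff. Qed.

Lemma subcontinuum_sub X Y A : X `<=` Y -> subcontinuum X A -> subcontinuum Y A.
Proof. by move=> XY [AX A0 cA conA]; split => //; exact: subset_trans XY. Qed.

Lemma subcontinuum_connected_component A Y x : compact A -> A `<=` Y -> A x ->
  subcontinuum Y (connected_component A x).
Proof.
move=> cA AY Ax; have clA : closed A.
  by apply: compact_closed cA; exact: metric_hausdorff.
have CA := @connected_component_sub T A x; split.
- exact: subset_trans AY.
- by exists x; exact: connected_component_refl.
- by apply: subclosed_compact cA CA; exact: component_closed.
- exact: component_connected.
Qed.

Lemma subcontinuumU X A B : subcontinuum X A -> subcontinuum X B ->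
  A `&` B !=set0 -> subcontinuum X (A `|` B).
Proof.
move=> [AX [a Aa] cA conA] [BX _ cB conB] AB; split.
- by rewrite subUset.
- by exists a; left.
- exact: compactU.
- exact: connectedU.
Qed.

Lemma subcontinuumU_bigcup X B (E : nat -> set T) n : subcontinuum X B ->
  (forall i, (i < n)%N -> subcontinuum X (E i)) ->
  (forall i, (i < n)%N -> E i `&` B !=set0) ->
  subcontinuum X (B `|` \bigcup_(i in `I_n) E i).
Proof.
move=> XB; rewrite bigcup_mkord; elim: n => [|n IH] XE EB.
  by rewrite big_ord0 setU0.
rewrite big_ord_recr /= setUA; apply: subcontinuumU; last first.
- have [x [Ex Bx]] := EB n (ltnSn n); exists x; split => //; by left.
- exact: XE.
- by apply: IH => i /leqW; [exact: XE|exact: EB].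
Qed.

Lemma closed_bigcup_ord (E : nat -> set T) n :
  (forall i, (i < n)%N -> closed (E i)) -> closed (\bigcup_(i in `I_n) E i).
Proof. by move=> cE; apply: closed_bigcup => //; exact: finite_II. Qed.

(** Otherwise the union of [B] and the three [E i] is a 3-od with core [B], since points of
    different [E i] outside [B] lie in different components. *)
Lemma atriodic_disjoint_ends X B (E : nat -> set T) : atriodic X ->
  subcontinuum X B ->
  (forall i, (i < 3)%N -> subcontinuum X (E i)) ->
  (forall i j, (i < 3)%N -> (j < 3)%N -> i <> j -> E i `&` E j = set0) ->
  (forall i, (i < 3)%N -> E i `&` B !=set0) ->
  ~ (forall i, (i < 3)%N -> ~ (E i `<=` B)).
Proof.
move=> atX XB XE disjE EB nEB.
have XZ := subcontinuumU_bigcup XB XE EB.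
set Z := (X in subcontinuum _ X) in XZ.
have ZB : subcontinuum Z B by case: XB => *; split => // x Bx; left.
apply: (atriodic_components atX XZ ZB).
(* For [i] beyond the range, where nothing is required, the default is a point of [B]. *)
have /choice[x Ex] : forall i, exists x, (i < 3)%N -> E i x /\ ~ B x.
  move=> i; have [i3|_] := boolP (i < 3)%N; last by case: XB => _ [b _]; exists b.
  apply: contrapT => nx; apply: (nEB _ i3) => y Ey; apply: contrapT => nBy.
  by apply: nx; exists y.
apply: (@card_components_ge3 _ x) => [i i3|i j i3 j3 ij].
  by have [Exi nBx] := Ex i i3; split => //; right; exists i.
move=> Cxj; set C := connected_component _ _ in Cxj.
(* The two other ends together: closed and disjoint from [E i], so a connected subset of [Z]\[B]
   lies in [E i] or in [D]. *)
pose D := \bigcup_(k in `I_3) (if k == i then set0 else E k).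
have cD : closed D.
  apply: closed_bigcup_ord => k k3; case: ifP => _; first exact: closed0.
  exact: subcontinuum_closed (XE _ k3).
have cEi : closed (E i) by exact: subcontinuum_closed (XE _ i3).
have ED : E i `&` D = set0.
  apply/seteqP; split => // y [Ey [k /= k3]]; case: eqP => // /nesym ki Eky.
  by rewrite -[False]/(set0 y) -(disjE i k).
have sepED : separated (E i) D.
  by rewrite /separated -(iffLR (closure_id _) cEi) -(iffLR (closure_id _) cD).
have CED : C `<=` E i `|` D.
  move=> y /connected_component_sub [[//|[k /= k3 Ey]] nBy].
  have [<-|/eqP ki] := eqVneq k i; first by left.
  by right; exists k => //; rewrite ifF//; exact/eqP.
have [|CE|CD] := connected_subset sepED CED; first exact: component_connected.
  rewrite -[False]/(set0 (x j)) -(disjE i j) //; split; first exact: CE.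
  by have [] := Ex j j3.
rewrite -[False]/(set0 (x i)) -ED; have [Exi nBx] := Ex i i3; split => //.
by apply: CD; apply: connected_component_refl; split => //; right; exists i.
Qed.
End components.

(** * Replacing extensions in [X] by extensions in [Y] *)

Section limits.
Context {R : realType} {T : metricType R}.
Implicit Types (X Y K : set T).

Lemma compact_open_neighborhood K (O : set T) : compact K -> open O ->
  K `<=` O -> exists2 d : R, 0 < d & neighborhood K d `<=` O.
Proof.
move=> /compact_near_coveringP cK oO KO.
have H : \forall d \near (0 : R)^'+, K `<=` (fun x => ball x d `<=` O).
  apply: (cK R (0 : R)^'+ (fun d x => ball x d `<=` O)) => x /KO Ox.
  have /nbhs_ballP[r /= r0 rO] : nbhs x O by exact: open_nbhs_nbhs.
  have r20 : 0 < r / 2 by rewrite divr_gt0.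
  exists (ball x (r / 2), [set d | d < r / 2]) => /=.
    by split; [exact: nbhsx_ballx|exact: nbhs_right_lt].
  move=> [y d]/= [xy dr] z yz; apply: rO; rewrite [r]splitr.
  by apply: ball_triangle xy _; apply: le_ball yz; exact: ltW.
have [d [Kd d0]] := filter_ex (filterI H (nbhs_right_gt (0 : R))).
exists d => //; rewrite neighborhoodE => y [x Kx xy]; exact: Kd xy.
Qed.

(** Among five indices, either [P] holds at three, or it fails at three and [Q] holds there. The
    function [u] lists three such indices. *)
Lemma majority5 (P Q : nat -> Prop) : (forall i, (i < 5)%N -> P i \/ Q i) ->
  exists u : nat -> nat, [/\ forall i, (i < 3)%N -> (u i < 5)%N,
    forall i j, (i < 3)%N -> (j < 3)%N -> i <> j -> u i <> u j
  & (forall i, (i < 3)%N -> P (u i)) \/ (forall i, (i < 3)%N -> Q (u i))].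
Proof.
move=> PQ; pose a := fun i => `[< P i >].
have sel (b : pred nat) : (3 <= count b (iota 0 5))%N ->
    exists u : nat -> nat, [/\ forall i, (i < 3)%N -> (u i < 5)%N,
      forall i j, (i < 3)%N -> (j < 3)%N -> i <> j -> u i <> u j
    & forall i, (i < 3)%N -> b (u i)].
  rewrite -size_filter; set s := [seq i <- _ | b i] => s3.
  have us : uniq s by exact/filter_uniq/iota_uniq.
  have lts i : (i < 3)%N -> (i < size s)%N by move/leq_trans; apply.
  have ms i : (i < 3)%N -> nth 0%N s i \in s by move/lts; exact: mem_nth.
  exists (nth 0%N s); split => [i /ms|i j /lts i3 /lts j3 ij /eqP|i /ms].
  - by rewrite mem_filter mem_iota => /andP[].
  - by rewrite nth_uniq// => /eqP.
  - by rewrite mem_filter => /andP[].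
have := count_predC a (iota 0 5); rewrite size_iota => count5.
have [/sel[u [u5 uinj Pu]]|ca] := leqP 3 (count a (iota 0 5)).
  by exists u; split => //; left => i /Pu /asboolP.
have /sel[u [u5 uinj Qu]] : (3 <= count (predC a) (iota 0 5))%N.
  rewrite leqNgt; apply/negP => cb.
  by have := leq_add ca cb; rewrite addSn addnS count5.
exists u; split => //; right => i i3.
by have [Pu|//] := PQ _ (u5 _ i3); have /asboolPn := Qu _ i3.
Qed.

(** The tolerance is fixed here. The nested radii [e / 2 / 2], [e / 2] and [e] leave room for taking
    a closure twice. *)
Lemma atriodic_extension_near X Y M' (M_ M'_ : nat -> set T) (e : R) :
  atriodic X -> subcontinuum X Y ->
  (forall n, subcontinuum Y (M_ n)) -> (forall n, subcontinuum X (M'_ n)) ->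
  (forall n, M_ n `<=` M'_ n) -> subcontinuum Y M' -> hausdorff_cvg M'_ M' ->
  0 < e ->
  \forall n \near \oo, exists Q, [/\ subcontinuum Y Q, M_ n `<=` Q,
    Q `<=` neighborhood M' e & M' `<=` neighborhood Q e].
Proof.
move=> atX XY YM_ XM'_ MM' YM' M'cvg e0.
have [YX Y0 cY conY] := XY; have [M'Y M'0 cM' conM'] := YM'.
have clY := subcontinuum_closed XY.
have e20 : 0 < e / 2 by rewrite divr_gt0.
have e40 : 0 < e / 2 / 2 by rewrite divr_gt0.
have M'lim d : 0 < d -> \forall n \near \oo,
    M'_ n `<=` neighborhood M' d /\ M' `<=` neighborhood (M'_ n) d.
  apply: (iffLR (hausdorff_cvgP _ _ cM' M'0) M'cvg) => n; by case: (XM'_ n).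
pose good n Q := [/\ subcontinuum Y Q, M_ n `<=` Q,
    Q `<=` neighborhood M' e & M' `<=` neighborhood Q e].
have /choice[x Mx] : forall n, exists x, M_ n x by move=> n; case: (YM_ n).
(* Closed, so that its components are continua, yet still within distance [e] of [M']. *)
pose F := Y `&` closure (neighborhood M' (e / 2)).
have cF : compact F by apply: compact_closedI => //; exact: closed_closure.
have FY : F `<=` Y by move=> y [].
have FN : F `<=` neighborhood M' e.
  by move=> y [_]; exact: neighborhood_closure.
have NF : Y `&` neighborhood M' (e / 2) `<=` F.
  by move=> y [Yy Ny]; split => //; exact: subset_closure.
pose E n := connected_component F (x n).
apply: contrapT => nnear.
pose bad n := [/\ M'_ n `<=` neighborhood M' (e / 2 / 2),
  M' `<=` neighborhood (M'_ n) e & ~ exists Q, good n Q].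
(* Bad indices are cofinal: every property that holds eventually holds at one of them. *)
have badN (P : set nat) : (\forall n \near \oo, P n) -> exists2 n, P n & bad n.
  move=> nearP; apply: contrapT => nbad; apply: nnear.
  apply: filterS3 nearP (M'lim _ e40) (M'lim _ e0) => n Pn [Mn _] [_ nM].
  apply: contrapT => nQ.
  by apply: nbad; exists n.
have N42 := @neighborhood_le _ _ M' (e / 2 / 2) (e / 2).
have half_le (d : R) : 0 < d -> d / 2 <= d.
  by move=> d0; rewrite [leRHS]splitr lerDl ltW// divr_gt0.
have le42 : e / 2 / 2 <= e / 2 by exact: half_le.
have badF n : bad n -> M_ n `<=` F.
  move=> [Mn _ _] y Mny; apply: NF; split.
    by have [MY _ _ _] := YM_ n; exact: MY.
  by apply: N42 => //; apply: Mn; exact: MM'.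
have badFx n : bad n -> F (x n) by move=> bn; exact: badF (Mx n).
have YE n : bad n -> subcontinuum Y (E n).
  by move=> bn; apply: subcontinuum_connected_component => //; exact: badFx.
(* If [E n] met the connected set [M'], it would contain it, and [E n] itself would be good. *)
have badE n : bad n -> E n `&` M' = set0.
  move=> bn; apply/seteqP; split => // z [Ez M'z].
  have M'E : M' `<=` E n.
    rewrite /E (same_connected_component Ez).
    apply: connected_component_max => // y M'y; apply: NF; split.
      exact: M'Y.
    exact: (sub_neighborhood e20).
  have [_ _ []] := bn; exists (E n); split.
  - exact: YE.
  - apply: connected_component_max => //; first exact: badF.
    by case: (YM_ n).
  - by apply: subset_trans FN; exact: connected_component_sub.
  - by apply: subset_trans M'E _; exact: sub_neighborhood.
(* Otherwise boundary bumping, applied to the connected set [Y], gives [Y]<=[F]. Then [E n] contains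
   [Y], hence meets [M']. *)
have badEN n : bad n -> ~ (E n `<=` neighborhood M' (e / 2)).
  move=> bn EN; have Fx := badFx _ bn.
  have YF : Y `<=` F.
    apply: (@connected_sub_of_component_disjoint _ _ F
      (~` neighborhood M' (e / 2)) Y (x n)) => //.
    - by apply: open_closedC; exact: neighborhood_open.
    - move=> y Yy; have [Ny|Ny] := pselect (neighborhood M' (e / 2) y).
        by left; exact: NF.
      by right.
    - exact: FY.
    - by apply/seteqP; split => // y [/EN].
  have [z M'z] := M'0; rewrite -[False]/(set0 z) -(badE n)//; split => //.
  by apply: connected_component_max (M'Y _ M'z) => //; exact: FY.
(* Otherwise [M'_ n] itself would be good. *)
have badM' n : bad n -> ~ (M'_ n `<=` Y).
  move=> [Mn nM nQ] M'nY; apply: nQ; exists (M'_ n); split => //.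
    by have [_ *] := XM'_ n.
  apply: subset_trans Mn _; apply: neighborhood_le.
  exact: le_trans le42 (half_le _ e0).
(* By induction on the number of indices: the union [A] of the components chosen so far is closed
   and misses [M']. A later bad [M'_ n] is close enough to [M'] to miss [A], so [x n] lies in a new
   component. *)
have [s sbad sdisj] : exists2 s : nat -> nat, (forall i, (i < 5)%N -> bad (s i)) &
    forall i j, (i < 5)%N -> (j < 5)%N -> i <> j -> E (s i) `&` E (s j) = set0.
  elim: 5%N => [|k [s sbad sdisj]]; first by exists id.
  pose A := \bigcup_(i in `I_k) E (s i).
  have cA : closed A.
    by apply: closed_bigcup_ord => i /sbad /YE; exact: subcontinuum_closed.
  have M'A : M' `<=` ~` A.
    move=> z M'z [i /= ik Ez]; rewrite -[False]/(set0 z) -(badE (s i)) //.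
    exact: sbad.
  have [d d0 dA] := compact_open_neighborhood cM' (closed_openC cA) M'A.
  have [n [Mnd _] bn] := badN _ (M'lim _ d0).
  have En i : (i < k)%N -> E (s i) `&` E n = set0.
    move=> ik; apply/seteqP; split => // z [Ez Enz].
    apply: (dA (x n)); first by apply: Mnd; exact: MM'.
    exists i => //; rewrite /E (same_connected_component Ez).
    exact: connected_component_sym.
  exists (fun i => if (i < k)%N then s i else n).
    by move=> i _; case: ifP => [/sbad//|].
  move=> i j; rewrite !ltnS [(i <= k)%N]leq_eqVlt [(j <= k)%N]leq_eqVlt =>
    /orP[/eqP->|ik] /orP[/eqP->|jk] //.
  - by move=> _; rewrite ltnn jk setIC; exact: En.
  - by move=> _; rewrite ltnn ik; exact: En.
  - by rewrite ik jk; exact: sdisj.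
have XZ : subcontinuum X (Y `|` \bigcup_(i in `I_5) M'_ (s i)).
  apply: subcontinuumU_bigcup => // i _; exists (x (s i)); split.
    by apply: MM'.
  by have [MY _ _ _] := YM_ (s i); exact: MY.
set U := \bigcup_(i in _) _ in XZ.
have ZY : subcontinuum (Y `|` U) Y by split => // y; left.
have [C [D [conC conD CD]]] := atriodic_setD_connectedU atX XZ ZY.
have UN : U `<=` neighborhood M' (e / 2 / 2).
  by move=> y [i /= /sbad[+ _ _]] => /[apply].
have CDU : C `|` D `<=` U by rewrite -CD => y [[]].
(* Outside [Y], the set [M'_ (s i)] lies in [C]|[D]. If [E (s i)] missed both closures, boundary
   bumping would keep [M'_ (s i)] inside [F], hence inside [Y]. *)
have meetCD i : (i < 5)%N ->
    E (s i) `&` closure C !=set0 \/ E (s i) `&` closure D !=set0.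
  move=> i5; have bi := sbad _ i5; apply: contrapT => /not_orP[nC nD].
  apply: (badM' _ bi); apply: subset_trans FY.
  apply: (@connected_sub_of_component_disjoint _ _ F
    (closure C `|` closure D) _ (x (s i))) => //.
  - by apply: closedU; exact: closed_closure.
  - by case: (XM'_ (s i)).
  - move=> y My; have [Yy|nYy] := pselect (Y y).
      left; apply: NF; split => //; apply: N42 => //; apply: UN.
      by exists i.
    have : (C `|` D) y by rewrite -CD; split => //; right; exists i.
    by case=> [Cy|Dy]; right; [left|right]; exact: subset_closure.
  - exact: MM'.
  - exact: badFx.
  - by apply/seteqP; split => // y [Ey [Cy|Dy]]; [apply: nC|apply: nD]; exists y.
have [u [u5 uinj CDu]] := majority5 meetCD.
(* The closure of [G] serves as the core: it stays within [e / 2] of [M'], whereas each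
   [E (s (u i))] leaves that neighborhood. *)
have main G : connected G -> G `<=` U ->
    ~ forall i, (i < 3)%N -> E (s (u i)) `&` closure G !=set0.
  move=> conG GU EG.
  have GN : closure G `<=` neighborhood M' (e / 2).
    apply: subset_trans (neighborhood_closure e20); apply: closureS.
    exact: subset_trans UN.
  have GZ : closure G `<=` Y `|` U.
    rewrite [X in _ `<=` X](iffLR (closure_id _) (subcontinuum_closed XZ)).
    by apply: closureS; apply: subset_trans GU _ => y; right.
  have XG : subcontinuum X (closure G).
    have [ZX _ cZ _] := XZ; split.
    - exact: subset_trans ZX.
    - by have [//|y [_ Gy]] := EG 0%N; exists y.
    - by apply: subclosed_compact cZ GZ; exact: closed_closure.
    - exact: connected_closure.
  apply: (atriodic_disjoint_ends atX XG _ _ EG).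
  - by move=> i /u5 /sbad /YE; exact: subcontinuum_sub.
  - by move=> i j i3 j3 ij; apply: sdisj; [exact: u5|exact: u5|exact: uinj].
  - by move=> i /u5 /sbad /badEN nEN EG'; apply: nEN; exact: subset_trans GN.
case: CDu; apply: main => //; apply: subset_trans CDU => y; by [left|right].
Qed.

(** For a fixed tolerance, good extensions exist only from some index on, and this index depends on
    the tolerance. A best choice at each index yields one sequence that serves all tolerances. *)
Lemma atriodic_extension X Y M' (M_ M'_ : nat -> set T) :
  atriodic X -> subcontinuum X Y ->
  (forall n, subcontinuum Y (M_ n)) -> (forall n, subcontinuum X (M'_ n)) ->
  (forall n, M_ n `<=` M'_ n) -> subcontinuum Y M' -> hausdorff_cvg M'_ M' ->
  exists Q_ : nat -> set T, [/\ forall n, subcontinuum Y (Q_ n),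
    forall n, M_ n `<=` Q_ n & hausdorff_cvg Q_ M'].
Proof.
move=> atX XY YM_ XM'_ MM' YM' M'cvg.
(* [Q_ n] is as good an approximation of [M'] as any extension of [M_ n], up to
   the precision [n.+1%:R^-1]. *)
pose close k (Q : set T) := Q `<=` neighborhood M' k.+1%:R^-1 /\
  M' `<=` neighborhood Q k.+1%:R^-1.
have close_le k l Q : (k <= l)%N -> close l Q -> close k Q.
  move=> kl [QM MQ]; have le_lk : l.+1%:R^-1 <= k.+1%:R^-1 :> R.
    by rewrite lef_pV2 ?posrE// ler_nat.
  by split; [apply: subset_trans QM _|apply: subset_trans MQ _];
    exact: neighborhood_le.
have best n m : exists Q, [/\ subcontinuum Y Q, M_ n `<=` Q &
    forall k, (k <= m)%N ->
    (exists Q', [/\ subcontinuum Y Q', M_ n `<=` Q' & close k Q']) -> close k Q].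
  pose ext k Q := [/\ subcontinuum Y Q, M_ n `<=` Q & close k Q].
  elim: m => [|m [Q [YQ MQ Qbest]]].
    have [[Q [YQ MQ Q0]]|nQ] := pselect (exists Q, ext 0%N Q).
      by exists Q; split => // k; rewrite leqn0 => /eqP->.
    (* Not even precision 1 is attainable, so nothing is required and [M_ n] serves as default. *)
    exists (M_ n); split => // k; rewrite leqn0 => /eqP-> //.
  have [[Q' [YQ' MQ' Q'm]]|nQ] := pselect (exists Q, ext m.+1 Q).
    by exists Q'; split => // k km _; exact: close_le Q'm.
  by exists Q; split => // k; rewrite leq_eqVlt => /orP[/eqP->//|]; exact: Qbest.
have /choice[Q_ Qbest] := fun n => best n n.
exists Q_; split => [n|n|]; first by have [] := Qbest n.
  by have [] := Qbest n.
have [_ M'0 cM' _] := YM'.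
apply/hausdorff_cvgP => //.
- by move=> n; have [[]] := Qbest n.
- by move=> n; have [[]] := Qbest n.
move=> e e0.
have [k] := @ltr_add_invr R 0 e e0; rewrite add0r => ke.
have k0 : 0 < k.+1%:R^-1 :> R by rewrite invr_gt0.
have := atriodic_extension_near atX XY YM_ XM'_ MM' YM' M'cvg k0.
(* From index [k] on, the precision [k.+1%:R^-1] is among those for which [Q_ n] is optimal. *)
have := nbhs_infty_ge k; apply: filterS2 => n kn [Q [YQ MQ QM' M'Q]].
have [_ _ /(_ _ kn)[]] := Qbest n; first by exists Q.
move=> QM MQ'; split; [apply: subset_trans QM _|apply: subset_trans MQ' _];
  apply: neighborhood_le; exact: ltW.
Qed.

(** The same sequence [M_] works in [X]. A competing limit [M'] lies in [K], hence in [Y], so it is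
    also the limit of extensions in [Y], to which maximality in [Y] applies. *)
Lemma atriodic_maximal_limit_continuum X Y K M : atriodic X ->
  subcontinuum X Y -> subcontinuum Y K ->
  maximal_limit_continuum Y K M -> maximal_limit_continuum X K M.
Proof.
move=> atX XY YK [KM [M_ [YM_ Mcvg Mmax]]]; split => //.
have [YX _ _ _] := XY; have [KY _ _ _] := YK.
exists M_; split => [n||M'_ M' XM'_ XM' M'cvg MM' M'K] //.
  exact: subcontinuum_sub (YM_ n).
have YM' : subcontinuum Y M'.
  by case: XM' => *; split => //; exact: subset_trans KY.
have [Q_ [YQ MQ Qcvg]] :=
  atriodic_extension atX XY YM_ XM'_ MM' YM' M'cvg.
exact: Mmax Qcvg MQ M'K.
Qed.

End limits.

Theorem corollary3p5 (R : realType) (T : metricType R) (X : set T) :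
  continuum X -> atriodic X -> semi_kelley X -> hereditarily_semi_kelley X.
Proof.
move=> _ atX skX Y XY K YK L M YL YM; have [YX _ _ _] := XY.
apply: (skX K); first exact: subcontinuum_sub YK.
- exact: atriodic_maximal_limit_continuum YL.
- exact: atriodic_maximal_limit_continuum YM.
Qed.
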